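(* Let $G$ be a finite solvable group. Then the following statements are equivalent: (1) $G$ is an SST-group. (2) Every subgroup of $G$ is either SS-permutable or abnormal in $G$. (3) Every subgroup of $G$ is either NSS-permutable or abnormal in $G$.
   Context: All groups are finite. Two subgroups $A,B$ of a group permute if $AB=BA$. A supplement of $H$ in $G$ is a subgroup $K\le G$ with $G=HK$. A subgroup $H$ of a group $G$ is SS-permutable in $G$ if $H$ has a supplement $K$ in $G$ such that $H$ permutes with every Sylow subgroup of $K$ (for all primes). $H$ is NSS-permutable in $G$ if $H$ has such a supplement $K$ which is moreover normal in $G$. $G$ is an SST-group if SS-permutability is transitive: whenever $H\le K\le G$, $H$ is SS-permutable in $K$ and $K$ is SS-permutable in $G$, then $H$ is SS-permutable in $G$. A subgroup $H$ of $G$ is abnormal in $G$ if $g\in\langle H,H^g\rangle$ for all $g\in G$, where $H^g=g^{-1}Hg$. *)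

(* Defs.v *)
From mathcomp Require Import all_boot all_fingroup all_solvable.

Set Implicit Arguments.
Unset Strict Implicit.
Unset Printing Implicit Defensive.

Local Open Scope group_scope.

Section Permutability.

Variable gT : finGroupType.
Implicit Types G H K P : {group gT}.

Definition supplement G H K : Prop := K \subset G /\ H * K = G.

(* [commute H P] is the equation H * P = P * H between complex products of
   subsets, i.e. H and P permute; it is not elementwise commutation. *)
Definition permutes_with_Sylows H K : Prop :=
  forall (p : nat) P, prime p -> p.-Sylow(K) P ->
    commute (H : {set gT}) (P : {set gT}).

Definition SS_permutable G H : Prop :=
  H \subset G /\
  exists K, supplement G H K /\ permutes_with_Sylows H K.

Definition NSS_permutable G H : Prop :=
  H \subset G /\
  exists K, [/\ supplement G H K, K <| G & permutes_with_Sylows H K].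

Definition SST_group G : Prop :=
  forall H K, H \subset K -> K \subset G ->
    SS_permutable K H -> SS_permutable G K -> SS_permutable G H.

Definition abnormal G H : Prop :=
  H \subset G /\ forall g, g \in G -> g \in <<H :|: H :^ g>>.

End Permutability.

(* Main.v *)
Require Import Defs.
From mathcomp Require Import all_boot all_fingroup all_solvable.

(** Each of the three conditions is equivalent to all subgroups of G being
    NSS-permutable, which clearly implies the three of them. So it has to be shown
    that an SST-group, and a group in which every subgroup is SS-permutable or
    abnormal, has only NSS-permutable subgroups.

    Both properties pass to quotients, and both imply that every subgroup of
    'O_p(G) is normalised by all p'-elements of G (pcore_SS_permutable_norm). For
    a solvable G this gives normal subgroups of prime order in every nontrivial
    quotient, hence a normal Sylow subgroup for the largest prime
    (largest_Sylow_normal). Since a p'-group X normalising all the subgroups of a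
    p-group P either centralises P or forces P = [P, X] to be abelian
    (power_action_abelian), induction on the order of G yields an abelian normal
    Hall subgroup L of G, all of whose subgroups are normal in G, with G / L
    nilpotent (power_residual_exists).

    Let D be a complement of L; it is nilpotent. Under either property every
    subgroup A of D is SS-permutable in G: D is SS-permutable with supplement L,
    A is SS-permutable in D, and no proper subgroup of D is abnormal in D. For
    subgroups A and R of D that permute, A permutes with all conjugates of R
    under L if and only if L = 'C_L(R) 'C_L(A) (commute_conj_cent_mul,
    cent_mul_commute_conj). As this only depends on the action on L, a supplement
    of A can be enlarged by 'C_D(L), and thus made normal, because G^`(1)
    centralises L. The enlarged supplement also serves every H whose
    pi(L)'-part is A, so H is NSS-permutable (power_residual_NSS). *)

Set Implicit Arguments.
Unset Strict Implicit.
Unset Printing Implicit Defensive.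

Local Open Scope group_scope.

(** * SS-permutable and abnormal subgroups *)

Section Basics.

Variable gT : finGroupType.
Implicit Types G H K N P Q X : {group gT}.

Lemma SS_permutable_normal G H : H <| G -> SS_permutable G H.
Proof.
move=> nsHG; split; first exact: normal_sub.
exists G; split; first by split; rewrite ?mulSGid ?normal_sub.
move=> p P _ sylP; apply/esym/normC.
exact: subset_trans (pHall_sub sylP) (normal_norm nsHG).
Qed.

Lemma NSS_permutable_SS G H : NSS_permutable G H -> SS_permutable G H.
Proof. by case=> sHG [K [supK _ permK]]; split=> //; exists K. Qed.

Lemma SS_permutable_nilpotent G H :
  nilpotent G -> H \subset G -> SS_permutable G H.
Proof.
move=> nilG sHG; split=> //; exists G; split; first by split; rewrite ?mulSGid.
move=> p P _ sylP; apply: normC; apply: subset_trans sHG _.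
by rewrite (nilpotent_Hall_pcore nilG sylP) gFnorm.
Qed.

(** Taking g in the normaliser of H shows that an abnormal subgroup is
    self-normalising, which a proper subgroup of a nilpotent group never is. *)
Lemma abnormal_nilpotent G H : nilpotent G -> abnormal G H -> H :=: G.
Proof.
move=> nilG [sHG abnH]; apply/eqP; rewrite eqEsubset sHG.
have -> : G :=: H.
  apply: (nilpotent_sub_norm nilG sHG); apply/subsetP=> g /setIP[Gg nHg].
  by have := abnH g Gg; rewrite (normP nHg) setUid genGid.
exact: subxx.
Qed.

Lemma abnormal_sub G H K :
  H \subset K -> K \subset G -> abnormal G H -> abnormal K H.
Proof.
move=> sHK sKG [_ abnH]; split=> // g Kg.
by apply: abnH; apply: (subsetP sKG).
Qed.

Lemma abnormal_sub_normal G H N :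
  N <| G -> H \subset N -> abnormal G H -> G \subset N.
Proof.
move=> nsNG sHN [_ abnH]; apply/subsetP=> g Gg.
apply: subsetP (abnH g Gg); rewrite gen_subG subUset sHN.
by rewrite -(normP (subsetP (normal_norm nsNG) g Gg)) conjSg.
Qed.

(** SS-permutability inside 'O_p(G) amounts to S-permutability: the index of K in
    G is a p-number, so a Sylow q-subgroup R of the supplement K is one of G, and
    X = 'O_p(G) :&: X R is normalised by R. All other Sylow q-subgroups of G are
    conjugate to R under G = K X. *)
Lemma pcore_SS_permutable_norm G X Q (p q : nat) :
    X \subset 'O_p(G) -> SS_permutable G X ->
    prime q -> q != p -> q.-Sylow(G) Q ->
  Q \subset 'N(X).
Proof.
move=> sXO [sXG [K [[sKG defG] permK]]] q_pr neq_qp sylQ.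
have pX : p.-group X by apply: pgroupS sXO (pcore_pgroup p G).
have q'GK : q^'.-nat #|G : K|.
  have -> : #|G : K| = #|X : K|.
    apply/eqP; rewrite -(eqn_pmul2l (cardG_gt0 K)) Lagrange //.
    by rewrite [X in _ == X]mulnC LagrangeMr defG.
  apply: pnat_dvd (dvdn_indexg _ _) _.
  by apply: sub_in_pnat pX => r _ /eqP->; rewrite !inE eq_sym.
have [R sylR] := Sylow_exists q K.
have sylRG : q.-Sylow(G) R.
  rewrite pHallE (subset_trans (pHall_sub sylR) sKG) (card_Hall sylR).
  by rewrite -(Lagrange sKG) partnM // (part_p'nat q'GK) muln1 eqxx.
have nXR (S : {group gT}) : q.-Sylow(K) S -> S \subset 'N(X).
  move=> sylS; have cXS := permK q S q_pr sylS.
  have groupXS : group_set (X * S) by apply/comm_group_setP.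
  have defX : X :=: 'O_p(G) :&: Group groupXS.
    rewrite /= setIC -group_modl // setIC.
    have -> : 'O_p(G) :&: S = 1.
      apply: coprime_TIg; apply: (@pnat_coprime p); first exact: pcore_pgroup.
      apply: sub_in_pnat (pHall_pgroup sylS) => r _ /eqP->.
      by rewrite !inE.
    by rewrite mulg1.
  rewrite defX; apply: normsI.
    apply: subset_trans (pHall_sub sylS) (subset_trans sKG _).
    exact: gFnorm.
  by apply: subset_trans (normG _); apply: mulG_subr.
have [g Gg ->] := Sylow_trans sylRG sylQ.
have : g^-1 \in X * K by rewrite defG groupV.
case/mulsgP=> x k Xx Kk /(canRL invgK)->; rewrite invMg conjsgM.
have sylRk : q.-Sylow(K) (R :^ k^-1)%G by rewrite pHallJ ?groupV.
rewrite -(normP (_ : x^-1 \in 'N('N(X)))) ?conjSg ?nXR //.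
by rewrite groupV; apply: subsetP Xx; apply: subset_trans (normG _) (normG _).
Qed.

End Basics.

(** * Coprime action by power automorphisms *)

Section PowerAction.

Variable gT : finGroupType.
Implicit Types A B C P X U : {group gT}.

(** The subgroups of a cyclic p-group form a chain. *)
Lemma cyclic_pgroup_TI (p : nat) C A B :
    p.-group C -> cyclic C -> A \subset C -> B \subset C -> A :&: B = 1 ->
  A :=: 1 \/ B :=: 1.
Proof.
move=> pC cycC sAC sBC tiAB.
have [n oA] := p_natP (pgroupS sAC pC); have [m oB] := p_natP (pgroupS sBC pC).
have [le_nm | /ltnW le_mn] := leqP n m.
  have : A \subset B by rewrite -(cardSg_cyclic cycC) // oA oB dvdn_exp2l.
  by move/setIidPl=> <-; left.
have : B \subset A by rewrite -(cardSg_cyclic cycC) // oA oB dvdn_exp2l.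
by move/setIidPr=> <-; right.
Qed.

Lemma coprime_comm_mul_cent P X :
    X \subset 'N(P) -> coprime #|P| #|X| -> solvable P ->
  P \subset [~: P, X] * 'C_P(X).
Proof.
move=> nPX coPX solP.
have nRP : P \subset 'N([~: P, X]) by apply: commg_norml.
have nRX : X \subset 'N([~: P, X]) by apply: commg_normr.
have sRP : [~: P, X] \subset P by rewrite commg_subl.
rewrite -quotientSK // coprime_quotient_cent // subsetI subxx.
by rewrite quotient_cents2 ?subxx.
Qed.

(** If a p'-group X normalises every subgroup of a p-group P, then X centralises
    P, or P is abelian and P = [P, X]. Let A = [P, X]; it also normalises every
    subgroup of P. For z, b in A the commutator [z, b] lies in <[z]> and in
    <[b]>, and comparing the powers by which an element of X acts on z, b and
    [z, b] shows that X fixes [z, b]. If X moves b it acts fixed-point-freely on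
    <[b]>, so b is central in A; hence A is abelian unless X centralises A, in
    which case X centralises P. When A is abelian, [A, X] contains an element u
    of order p that X moves; an element c of order p in 'C_P(X) would commute
    with u, and X would not normalise <[c * u]>. So 'C_P(X) = 1 and P = A. *)
Lemma power_action_abelian (p : nat) P X :
    p.-group P -> p^'.-group X ->
    (forall U, U \subset P -> X \subset 'N(U)) ->
  X \subset 'C(P) \/ abelian P /\ P :=: [~: P, X].
Proof.
move=> pP p'X nUX.
have coX U : U \subset P -> coprime #|U| #|X|.
  by move=> sUP; apply: pnat_coprime (pgroupS sUP pP) p'X.
have solP := nilpotent_sol (pgroup_nil pP).
have nPX := nUX P (subxx P).
have defP := coprime_comm_mul_cent nPX (coX P (subxx P)) solP.
pose A := [~: P, X]%G.
have sAP : A \subset P by rewrite commg_subl.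
have nUA U : U \subset P -> A \subset 'N(U).
  (* X normalises every conjugate of U in P, so all P-conjugates of X
     normalise U. *)
  move=> sUP; rewrite gen_subG; apply/subsetP=> _ /imset2P[g x Pg Xx ->].
  have sUgP : U :^ g^-1 \subset P by rewrite conj_subG ?groupV.
  have /normP nx := subsetP (nUX (U :^ g^-1)%G sUgP) x^-1 (groupVr Xx).
  have /normP nx' := subsetP (nUX U sUP) x Xx.
  by apply/normP; rewrite /commg /conjg !conjsgM nx conjsgKV nx'.
(* Every commutator of elements of A is fixed by X. *)
have fixA b z : b \in A -> z \in A -> [~ z, b] \in 'C(X).
  move=> Ab Az; apply/centP=> x Xx; set w := [~ z, b].
  have sbP : <[b]> \subset P by rewrite cycle_subG (subsetP sAP).
  have szP : <[z]> \subset P by rewrite cycle_subG (subsetP sAP).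
  have zw : w \in <[z]>.
    rewrite /w commgEl groupM ?groupV ?cycle_id //.
    by rewrite memJ_norm ?cycle_id // (subsetP (nUA _ szP)).
  have bw : w \in <[b]>.
    rewrite /w commgEr groupM ?cycle_id // memJ_norm ?groupV ?cycle_id //.
    by rewrite (subsetP (nUA _ sbP)).
  have /cycleP[k xz] : z ^ x \in <[z]>.
    by rewrite memJ_norm ?cycle_id // (subsetP (nUX _ szP)).
  have /cycleP[l xb] : b ^ x \in <[b]>.
    by rewrite memJ_norm ?cycle_id // (subsetP (nUX _ sbP)).
  have powx u v j : u ^ x = u ^+ j -> v \in <[u]> -> v ^ x = v ^+ j.
    by move=> ux /cycleP[i ->]; rewrite conjXg ux -!expgM mulnC.
  have wx := powx _ _ _ xz zw.
  have wxl : w ^ x = (w ^ x) ^+ l.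
    (* w = [z, b] is central in <<z, b>>, so w ^ x = w ^+ (k * l). *)
    have czw : commute z w by case/cycleP: zw => i ->; apply/commuteX.
    have cbw : commute b w by case/cycleP: bw => i ->; apply/commuteX.
    by rewrite [in RHS]wx -expgM -commXXg // -xz -xb -conjRg.
  have : (w ^ x) ^ x = w ^ x.
    rewrite [RHS]wxl (powx b _ l) //.
    by rewrite memJ_norm // (subsetP (nUX _ sbP)).
  by move/conjg_inj=> wxx; apply/commgP/conjg_fixP.
have [cAX | ncAX] := boolP (X \subset 'C(A)).
  left; rewrite centsC; apply: subset_trans defP _.
  by rewrite mul_subG ?subsetIr // centsC.
right.
(* Coprime action on the cyclic p-group <[b]>: [<[b]>, X] and 'C_(<[b]>)(X) meet
   trivially, so one of them is trivial. *)
have TIcyc b : b \in A -> <[b]> :&: 'C(X) = 1 \/ b \in 'C(X).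
  move=> Ab; have sbA : <[b]> \subset A by rewrite cycle_subG.
  have sbP := subset_trans sbA sAP.
  have nbX := nUX _ sbP.
  have sRb : [~: <[b]>, X] \subset <[b]> by rewrite commg_subl.
  have TI : [~: <[b]>, X] :&: 'C_(<[b]>)(X) = 1.
    rewrite setIA (setIidPl sRb).
    exact: coprime_abel_cent_TI nbX (coX _ sbP) (cycle_abelian b).
  have [/eqP | ->] := cyclic_pgroup_TI (pgroupS sbP pP) (cycle_cyclic b) sRb
                        (subsetIl _ _) TI; last by left.
  by move/eqP/commG1P; rewrite cycle_subG; right.
have abA : abelian A.
  have sub b : b \in A -> b \notin 'C(X) -> b \in 'C(A).
    move=> Ab; case: (TIcyc b Ab) => [TIb _ | ->//].
    apply/centP=> z Az; apply/commute_sym/commgP; rewrite -in_set1 -[[set 1]]TIb.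
    rewrite inE fixA // andbT commgEr groupM ?cycle_id //.
    rewrite memJ_norm ?groupV ?cycle_id // (subsetP (nUA _ _)) //.
    by rewrite cycle_subG (subsetP sAP).
  have [b Ab ncb] : exists2 b, b \in A & b \notin 'C(X).
    by apply/subsetPn; rewrite centsC.
  apply/subsetP=> a Aa; have [ca | /sub->//] := boolP (a \in 'C(X)).
  (* a is fixed by X, but neither b nor a * b is. *)
  rewrite -(groupMr _ (sub b Ab ncb)).
  by apply: sub; [apply: groupM | rewrite groupMl].
have nAX := nUX A sAP.
pose B := [~: A, X]%G.
have sBA : B \subset A by rewrite commg_subl.
have TIB : B :&: 'C(X) = 1 by apply: coprime_abel_cent_TI; rewrite ?coX.
have ntB : B :!=: 1 by apply: contra ncAX => /eqP/commG1P; rewrite centsC.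
have tiC : 'C_P(X) = 1.
  apply/eqP/idPn => ntC.
  have [p_pr pC _] := pgroup_pdiv (pgroupS (subsetIl P 'C(X)) pP) ntC.
  have [_ pB _] := pgroup_pdiv (pgroupS (subset_trans sBA sAP) pP) ntB.
  have [c /setIP[Pc cXc] oc] := Cauchy p_pr pC.
  have [u Bu ou] := Cauchy p_pr pB.
  have Au := subsetP sBA u Bu.
  have sccX : <[c]> \subset 'C(X) by rewrite cycle_subG.
  (* [c, u] lies in <[c]>, which X centralises, and in B = [A, X]. *)
  have cnu : commute c u.
    apply/commgP; rewrite -in_set1 -[[set 1]]TIB inE; apply/andP; split.
      rewrite commgEr groupM // memJ_norm ?groupV //.
      rewrite -cycle_subG normsR // cycle_subG.
        exact: subsetP (commg_norml _ _) c Pc.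
      by apply: (subsetP (cent_sub X)).
    apply: (subsetP sccX); rewrite commgEl groupM ?groupV ?cycle_id //.
    rewrite memJ_norm ?cycle_id //; apply: (subsetP (nUA _ _)) => //.
    by rewrite cycle_subG.
  have [x Xx xu] : exists2 x, x \in X & u ^ x != u.
    have /subsetPn[x Xx ncux] : ~~ (X \subset 'C[u]).
      apply/negP; rewrite sub_cent1 => cXu.
      have: u \in B :&: 'C(X) by rewrite inE Bu.
      by rewrite TIB => /set1P u1; rewrite -ou u1 order1 in p_pr.
    exists x => //; apply: contra ncux => /eqP/conjg_fixP/commgP cux.
    exact/cent1P.
  have scuP : <[c * u]> \subset P.
    by rewrite cycle_subG groupM ?(subsetP sAP u).
  (* (c * u) ^ x = c * u ^ x is a power of c * u; compare both components. *)
  have /cycleP[j] : (c * u) ^ x \in <[c * u]>.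
    by rewrite memJ_norm ?cycle_id // (subsetP (nUX _ scuP)).
  have -> : (c * u) ^ x = c * u ^ x.
    rewrite conjMg; congr (_ * _); apply/conjg_fixP/commgP.
    exact: (centP cXc).
  rewrite expgMn // => def_cux.
  have Bux : u ^ x \in B.
    by rewrite memJ_norm // (subsetP _ x Xx) // commg_normr.
  have cj1 : (c ^+ j)^-1 * c = 1.
    apply/set1P; rewrite -[[set 1]]TIB inE andbC groupM ?groupV ?groupX //=.
    have -> : (c ^+ j)^-1 * c = u ^+ j * (u ^ x)^-1.
      by apply: (canLR (mulKg _)); rewrite mulgA -def_cux mulgK.
    by rewrite groupM ?groupV ?groupX.
  have cj : c ^+ j = c by rewrite -[LHS]mulg1 -cj1 mulKVg.
  move: def_cux; rewrite cj => /mulgI ux; case/eqP: xu; rewrite ux.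
  apply/eqP; rewrite -[X in _ == X]expg1 eq_expg_mod_order ou -oc.
  by rewrite -eq_expg_mod_order cj expg1.
have defPA : P :=: A.
  by apply/eqP; rewrite eqEsubset sAP andbT; rewrite tiC mulg1 in defP.
by rewrite {1}defPA.
Qed.

End PowerAction.

(** * The abelian Hall subgroup with nilpotent quotient *)

Section Structure.

Implicit Types gT : finGroupType.

(** Every subgroup of 'O_p(G) is normalised by the Sylow q-subgroups of G, for
    all primes q <> p. Here p may be any natural number. *)
Definition Sylows_norm_pcore gT (G : {group gT}) : Prop :=
  forall (p q : nat) (X Q : {group gT}), X \subset 'O_p(G) ->
    prime q -> q != p -> q.-Sylow(G) Q -> Q \subset 'N(X).

(** L is a normal Hall subgroup of G with nilpotent quotient, contained in the
    derived subgroup, on which G acts by power automorphisms, i.e. every subgroup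
    of L is normal in G. Such an L is abelian (normal_subgroups_abelian). *)
Definition power_residual gT (G L : {group gT}) : Prop :=
  [/\ L <| G, Hall G L, L \subset G^`(1), nilpotent (G / L)
    & forall X : {group gT}, X \subset L -> X <| G].

(** The automorphism group of a cyclic group is abelian. *)
Lemma normal_cyclic_der1_cent gT (G C : {group gT}) :
  cyclic C -> C <| G -> G^`(1) \subset 'C(C).
Proof.
move=> cycC nsCG; have nCG := normal_norm nsCG.
rewrite -ker_conj_aut -sub_morphim_pre ?(subset_trans (der_sub 1 G)) //.
rewrite morphim_der //; apply/trivgP/commG1P.
exact: abelianS (Aut_conj_aut _ _) (Aut_cyclic_abelian cycC).
Qed.

Lemma normal_subgroups_der1_cent gT (G L : {group gT}) :
  (forall X : {group gT}, X \subset L -> X <| G) -> G^`(1) \subset 'C(L).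
Proof.
move=> nsXG; rewrite centsC; apply/subsetP=> x Lx.
rewrite -cycle_subG centsC normal_cyclic_der1_cent ?cycle_cyclic //.
by apply: nsXG; rewrite cycle_subG.
Qed.

Lemma normal_subgroups_abelian gT (G L : {group gT}) :
    (forall X : {group gT}, X \subset L -> X <| G) -> L \subset G^`(1) ->
  abelian L.
Proof.
by move=> nsXG sLG'; apply: subset_trans sLG' (normal_subgroups_der1_cent nsXG).
Qed.

(** A central element of order p of a Sylow p-subgroup, taken inside 'O_p(G),
    generates a subgroup normalised by a Sylow q-subgroup for every prime q. *)
Lemma exists_prime_normal gT (G : {group gT}) :
    solvable G -> G :!=: 1 -> Sylows_norm_pcore G ->
  exists2 X : {group gT}, X <| G & prime #|X|.
Proof.
move=> solG ntG nG.
have ntF : 'F(G) != 1 by rewrite trivg_Fitting.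
pose p := pdiv #|'F(G)|.
have p_pr : prime p by rewrite pdiv_prime // cardG_gt1.
have ntO : 'O_p(G) != 1.
  apply: contraNneq ntF => O1.
  have sylF := nilpotent_pcore_Hall p (Fitting_nil G).
  have: 'O_p('F(G)) \subset 'O_p(G).
    by apply: pcore_max; rewrite ?pcore_pgroup ?gFnormal_trans ?Fitting_normal.
  rewrite O1 => /trivgP F1; move/card_Hall: sylF; rewrite F1 cards1.
  move/esym/eqP; rewrite p_part -(expn0 p) eqn_exp2l ?prime_gt1 //.
  by rewrite -leqn0 leqNgt logn_gt0 mem_primes p_pr cardG_gt0 pdiv_dvd.
have [P sylP] := Sylow_exists p G.
have sOP := pcore_sub_Hall sylP.
have nsOP : 'O_p(G) <| P := normalS sOP (pHall_sub sylP) (pcore_normal _ _).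
have ntZ := meet_center_nil (pgroup_nil (pHall_pgroup sylP)) nsOP ntO.
have [_ pZ _] := pgroup_pdiv (pgroupS (subsetIl _ 'Z(P)) (pcore_pgroup p G)) ntZ.
have [x /setIP[Ox /setIP[Px cPx]] ox] := Cauchy p_pr pZ.
have sxO : <[x]> \subset 'O_p(G) by rewrite cycle_subG.
exists <[x]>%G; last by rewrite -[#|_|]/(#[x]) ox.
rewrite /normal (subset_trans sxO (pcore_sub _ _)).
pose T := [set Q : {group gT} | Q \subset 'N_G(<[x]>)].
rewrite -(@Sylow_transversal_gen _ T G); first last.
- move=> q; rewrite mem_primes => /and3P[q_pr _ _].
  have [-> | qp] := eqVneq q p.
    exists P => //; rewrite inE subsetI (pHall_sub sylP) cents_norm //.
    by rewrite centsC cycle_subG.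
  have [Q sylQ] := Sylow_exists q G; exists Q => //.
  by rewrite inE subsetI (pHall_sub sylQ) (nG p q).
- by move=> Q; rewrite inE subsetI => /andP[].
rewrite gen_subG; apply/bigcupsP=> Q.
by rewrite inE subsetI => /andP[].
Qed.

(** Aut N has order #|N| - 1, which is coprime to the larger prime p. *)
Lemma prime_normal_cent gT (N P : {group gT}) (p : nat) :
    prime p -> prime #|N| -> #|N| <= p -> P \subset 'N(N) -> p.-group P ->
  #|N| != p -> P \subset 'C(N).
Proof.
move=> p_pr N_pr le_Np nNP pP neqNp.
rewrite -ker_conj_aut -sub_morphim_pre //; apply/trivgP.
apply: card1_trivg; apply/eqP; rewrite -dvdn1.
have co : coprime #|conj_aut N @* P| #|Aut N|.
  apply: (@pnat_coprime p); first exact: morphim_pgroup.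
  rewrite card_Aut_cyclic ?prime_cyclic // totient_prime //.
  have lt_Np : #|N|.-1 < p.
    by rewrite prednK ?prime_gt0 // (leq_trans _ le_Np).
  rewrite p'natE // gtnNdvd // -subn1 subn_gt0 prime_gt1 //.
have /gcdn_idPl := cardSg (Aut_conj_aut N P).
by rewrite (eqP co) => <-.
Qed.

(** P is characteristic in N <*> P, being a normal Sylow subgroup of it. *)
Lemma cent_join_Sylow_normal gT (N P G : {group gT}) (p : nat) :
  N <*> P <| G -> p.-Sylow(G) P -> P \subset 'C(N) -> P <| G.
Proof.
move=> nsM sylP cNP; have sPM := joing_subr N P.
have sylPM := pHall_subl sPM (normal_sub nsM) sylP.
have nsPM : P <| N <*> P.
  by rewrite /normal sPM join_subG normG cents_norm // centsC.
by rewrite -(normal_Hall_pcore sylPM nsPM) gFnormal_trans.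
Qed.

Section Closed.

(** T stands for any group property that is inherited by quotients and implies
    Sylows_norm_pcore; this is the form in which the results below can be proved
    by induction on the order of G, through quotients. *)
Variable T : forall gT, {group gT} -> Prop.
Hypothesis T_quotient :
  forall gT (G N : {group gT}), N <| G -> T G -> T (G / N)%G.
Hypothesis T_pcore : forall gT (G : {group gT}), T G -> Sylows_norm_pcore G.

(** The Sylow tower property of supersolvable groups. Let N be a normal subgroup
    of prime order; by induction N P is normal in G. If #|N| = p then N <= P,
    and otherwise #|N| < p, so P centralises N. *)
Lemma largest_Sylow_normal gT (G P : {group gT}) (p : nat) :
    solvable G -> T G -> prime p -> {in \pi(G), forall r, r <= p} ->
  p.-Sylow(G) P -> P <| G.
Proof.
move=> solG TG p_pr; move: {2}_.+1 (ltnSn #|G|) => n.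
elim: n => // n IHn in gT G P solG TG *; rewrite ltnS => leGn pmax sylP.
have [G1 | ntG] := eqVneq (G : {set gT}) 1.
  have P1 : P :=: 1 by apply/trivgP; rewrite -G1 (pHall_sub sylP).
  by rewrite P1 normal1.
have [N nsNG N_pr] := exists_prime_normal solG ntG (T_pcore TG).
have nNG := normal_norm nsNG.
have nNP := subset_trans (pHall_sub sylP) nNG.
have nsM : N <*> P <| G.
  rewrite norm_joinEr // -quotientK // -(quotientGK nsNG) cosetpre_normal.
  apply: (IHn _ (G / N)%G (P / N)%G); rewrite ?quotient_sol ?quotient_pHall //.
  - exact: T_quotient.
  - apply: leq_trans leGn; rewrite ltn_quotient ?normal_sub //.
    by rewrite -cardG_gt1 prime_gt1.
  move=> r /(pi_of_dvd (dvdn_quotient _ _)) rG; apply: pmax.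
  by apply: rG; rewrite cardG_gt0.
have le_Np : #|N| <= p.
  by apply: pmax; rewrite mem_primes N_pr cardG_gt0 cardSg ?normal_sub.
have [Np | neqNp] := eqVneq #|N| p.
  have sNP : N \subset P.
    apply: subset_trans (pcore_sub_Hall sylP); apply: pcore_max => //.
    by rewrite /pgroup Np pnat_id.
  by rewrite (joing_idPr sNP) in nsM.
apply: (cent_join_Sylow_normal nsM sylP).
exact: prime_normal_cent (pHall_pgroup sylP) neqNp.
Qed.

(** X is a normal Hall, hence characteristic, subgroup of P <*> X. *)
Lemma normal_p'subgroup gT (G P X : {group gT}) (p : nat) :
    P <| G -> p.-group P -> p^'.-group X -> X \subset G -> X \subset 'C(P) ->
  X / P <| G / P -> X <| G.
Proof.
move=> nsPG pP p'X sXG cPX nsXP; have nPX := subset_trans sXG (normal_norm nsPG).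
have nsM : P <*> X <| G.
  by rewrite norm_joinEr // -quotientK // -(quotientGK nsPG) cosetpre_normal.
have nsXM : X <| P <*> X.
  by rewrite /normal joing_subr join_subG normG andbT cents_norm // centsC.
have hallX : p^'.-Hall(P <*> X) X.
  rewrite /pHall joing_subr p'X pnatNK norm_joinEr //= -normC // indexMg.
  exact: pnat_dvd (dvdn_indexg _ _) pP.
by rewrite -(normal_Hall_pcore hallX nsXM) gFnormal_trans.
Qed.

Lemma quotient_TI_abelian gT (H P : {group gT}) :
  H \subset 'N(P) -> P :&: H = 1 -> abelian (H / P) -> abelian H.
Proof.
move=> nPH tiPH; rewrite /abelian quotient_cents2 // => sHHP.
apply/commG1P/trivgP; rewrite -tiPH subsetI sHHP.
by rewrite commg_subl normG.
Qed.

(** Let P be the normal Sylow subgroup for the largest prime p, M a complement to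
    it, and L1 / P the subgroup obtained by induction in G / P. By
    power_action_abelian either M centralises P, and then G = P x M and
    L1 :&: M is as wanted; or P is abelian and P = [P, M], so that
    P <= G^`(1), whence L1 <= G^`(1) <= 'C(P) and L1 itself is as wanted. *)
Theorem power_residual_exists gT (G : {group gT}) :
  solvable G -> T G -> exists L : {group gT}, power_residual G L.
Proof.
move=> solG TG; move: {2}_.+1 (ltnSn #|G|) => n.
elim: n => // n IHn in gT G solG TG *; rewrite ltnS => leGn.
have [G1 | ntG] := eqVneq (G : {set gT}) 1.
  exists G; split; rewrite ?normal_refl //.
  - by rewrite /Hall subxx indexgg coprimen1.
  - by rewrite [in X in X \subset _]G1 sub1G.
  - by rewrite trivg_quotient nilpotent1.
  by move=> X; rewrite G1 => /trivgP->; rewrite normal1.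
pose p := max_pdiv #|G|.
have p_pr : prime p by rewrite max_pdiv_prime // cardG_gt1.
have [P sylP] := Sylow_exists p G.
have nsPG : P <| G.
  apply: (largest_Sylow_normal solG TG p_pr _ sylP) => r.
  exact: max_pdiv_max.
have [sPG nPG] := andP nsPG; have pP := pHall_pgroup sylP.
have ltGP : #|G / P| < n.
  apply: leq_trans leGn; rewrite ltn_quotient //.
  rewrite -cardG_gt1 (card_Hall sylP) p_part -(expn0 p).
  by rewrite ltn_exp2l ?prime_gt1 // logn_gt0 pi_max_pdiv cardG_gt1.
have [Lb [nsLb hallLb sLbG' nilLb nsXb]] :=
  IHn _ (G / P)%G (quotient_sol P solG) (T_quotient nsPG TG) ltGP.
have [L1 defLb sPL1 nsL1] := inv_quotientN nsPG nsLb.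
have sL1G := normal_sub nsL1.
have [M hallM] := Hall_exists p^' solG.
have [sMG p'M _] := and3P hallM.
have defG : P * M = G.
  by apply: sdprodW; apply/(sdprod_normal_p'HallP nsPG hallM).
have tiPM : P :&: M = 1 := coprime_TIg (pnat_coprime pP p'M).
have nPM := subset_trans sMG nPG.
(* M is generated by Sylow subgroups of G for primes other than p. *)
have nMU (U : {group gT}) : U \subset P -> M \subset 'N(U).
  move=> sUP; rewrite -(Sylow_gen M) gen_subG.
  apply/bigcupsP=> Q /SylowP[q q_pr sylQ].
  have [qp | qp] := eqVneq q p.
    have Q1 : Q :=: 1.
      rewrite -(setIid Q); apply/coprime_TIg/(pnat_coprime _ _ (pi := p)).
        by rewrite -qp; apply: pHall_pgroup sylQ.
      exact: pgroupS (pHall_sub sylQ) p'M.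
    by rewrite Q1 sub1G.
  have sylQG : q.-Sylow(G) Q by apply: subHall_Sylow hallM _ sylQ.
  apply: (T_pcore TG _ q_pr qp sylQG); apply: subset_trans sUP _.
  exact: pcore_max.
have hallL1 : coprime #|L1| #|G : L1|.
  rewrite -(Lagrange sPL1) coprimeMl -[#|_ : P|]card_quotient ?(subset_trans sL1G) //.
  have [_] := andP hallLb.
  rewrite /= defLb index_quotient_eq ?(subset_trans (subsetIr _ _)) // andbC => ->.
  have [_ _ p'GP] := and3P sylP; apply: pnat_coprime pP _.
  by apply: pnat_dvd p'GP; rewrite indexgS.
have nilL1 : nilpotent (G / L1).
  by rewrite -(isog_nil (third_isog sPL1 nsPG nsL1)) /= -defLb.
have sL1PG' : L1 \subset P * G^`(1).
  rewrite -quotientK ?(subset_trans (der_sub 1 G)) //.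
  rewrite -sub_quotient_pre ?(subset_trans sL1G) //= -defLb.
  by rewrite quotient_der.
have defL1 : P * (L1 :&: M) = L1.
  by rewrite setIC group_modl // defG; apply/setIidPr.
have tiPL : P :&: (L1 :&: M) = 1.
  by rewrite setIA (setIC P) -setIA tiPM setIC setI1g.
have abL : abelian (L1 :&: M).
  apply: (quotient_TI_abelian (P := P)) => //.
    by rewrite (subset_trans (subsetIr _ _)).
  have abLb : abelian Lb.
    by apply: normal_subgroups_abelian nsXb _.
  by apply: abelianS abLb; rewrite defLb quotientS ?subsetIl.
have nsX (X : {group gT}) :
  p^'.-group X -> X \subset L1 -> X \subset 'C(P) -> X <| G.
  move=> p'X sXL1 cPX.
  apply: (normal_p'subgroup nsPG pP p'X (subset_trans sXL1 sL1G) cPX).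
  by apply: nsXb; rewrite defLb quotientS.
have [cPM | [abP defP]] := power_action_abelian pP p'M nMU.
  have nsMG : M <| G.
    by rewrite /normal sMG -defG mulG_subG normG cents_norm // centsC.
  have p'L : p^'.-group (L1 :&: M) by apply: pgroupS p'M; rewrite subsetIr.
  exists (L1 :&: M)%G; split=> [|||| X].
  - exact: normalI.
  - rewrite /Hall subIset ?sL1G //= -(Lagrange_index sL1G) ?subsetIl //.
    rewrite coprimeMr (coprime_dvdl _ hallL1) ?cardSg ?subsetIl //=.
    have nPL : L1 :&: M \subset 'N(P) by rewrite subIset // (subset_trans sL1G).
    have dv : #|L1 : L1 :&: M| %| #|P|.
      by rewrite -{1}defL1 -(normC nPL) indexMg dvdn_indexg.
    rewrite coprime_sym; apply: (pnat_coprime _ p'L).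
    exact: pnat_dvd dv pP.
  (* Modulo G^`(1) the p'-group L1 :&: M lies in the image of the p-group P. *)
  - set D := G^`(1); have nDG : G \subset 'N(D) by apply: der_norm.
    have nDL : L1 :&: M \subset 'N(D) by rewrite subIset ?(subset_trans sL1G).
    have TI : P / D :&: (L1 :&: M) / D = 1.
      apply: coprime_TIg (pnat_coprime (quotient_pgroup D pP) _).
      exact: quotient_pgroup p'L.
    rewrite -quotient_sub1 //= -/D -TI.
    rewrite subsetI subxx andbT.
    apply: (subset_trans (quotientS D (subset_trans (subsetIl _ _) sL1PG'))).
    by rewrite quotientMidr.
  (* Modulo L1 :&: M, G is the central product of the images of P and M, and
     M / (L1 :&: M) is isomorphic to M / L1. *)
  - have nLG : G \subset 'N(L1 :&: M) by rewrite normal_norm ?normalI.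
    rewrite -defG quotientMl ?(subset_trans sPG) // mulg_nil.
      rewrite quotient_nil ?(pgroup_nil pP) //=.
      rewrite (isog_nil (second_isog _)) ?(subset_trans sMG) ?normal_norm //.
      exact: nilpotentS (quotientS _ sMG) nilL1.
    by rewrite quotient_cents.
  - rewrite subsetI => /andP[sXL1 sXM]; apply: nsX => //.
      exact: pgroupS sXM p'M.
    exact: subset_trans cPM.
exists L1.
have nsUG (U : {group gT}) : U \subset P -> U <| G.
  move=> sUP; rewrite /normal (subset_trans sUP) // -defG mulG_subG nMU //.
  by rewrite andbT cents_norm // centsC (subset_trans sUP).
have sPG' : P \subset G^`(1) by rewrite defP commgSS.
have sL1G' : L1 \subset G^`(1).
  by apply: subset_trans sL1PG' _; rewrite mul_subG.
have cPL1 : L1 \subset 'C(P).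
  exact: subset_trans sL1G' (normal_subgroups_der1_cent nsUG).
have abL1 : abelian L1.
  by rewrite -defL1 abelianM abP abL /= (subset_trans (subsetIl _ _)).
split=> // [|X sXL1]; first by rewrite /Hall sL1G.
(* The p-part of X lies in P, and nsX applies to its p'-part. *)
have /dprodP[_ defX _ _] := nilpotent_pcoreC p (abelian_nil (abelianS sXL1 abL1)).
rewrite -defX normalM //.
  apply: nsUG; rewrite (sub_normal_Hall sylP) ?pcore_pgroup //.
  exact: subset_trans (pcore_sub _ _) (subset_trans sXL1 sL1G).
have sXX := subset_trans (pcore_sub p^' X) sXL1.
by apply: nsX; rewrite ?pcore_pgroup // (subset_trans sXX).
Qed.

End Closed.
End Structure.

(** * Normal supplements *)

Section Supplements.

Variables (gT : finGroupType) (G L : {group gT}).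
Implicit Types A D E H K R S X : {group gT}.

(** For x in X the commutator [x, u] lies in L and in D. *)
Lemma conj_sub_complement_cent D X u :
    L <| G -> D \subset G -> L :&: D = 1 -> X \subset D -> u \in L ->
  X :^ u \subset D -> u \in 'C(X).
Proof.
move=> nsLG sDG tiLD sXD Lu sXuD; apply/centP=> x Xx.
apply/commute_sym/commgP; rewrite -in_set1 -[[set 1]]tiLD inE.
have Dx := subsetP sXD x Xx; apply/andP; split.
  rewrite commgEr groupM // memJ_norm ?groupV //.
  exact: subsetP (normal_norm nsLG) x (subsetP sDG x Dx).
by rewrite commgEl groupM ?groupV // (subsetP sXuD) // memJ_conjg.
Qed.

Section Hall.

Hypotheses (solG : solvable G) (nsLG : L <| G) (hallL : Hall G L).
Let pi := \pi(L).
Variable D : {group gT}.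
Hypothesis hallD : pi^'.-Hall(G) D.

Let sDG := pHall_sub hallD.
Let pi'D := pHall_pgroup hallD.

Lemma Hall_complement_mul : L * D = G.
Proof.
by apply: sdprodW; apply/(sdprod_normal_p'HallP nsLG hallD); apply: Hall_pi.
Qed.

Lemma Hall_complement_TI : L :&: D = 1.
Proof. by apply: coprime_TIg; apply: pnat_coprime (pgroup_pi L) pi'D. Qed.

Lemma sub_conj_complement S :
  S \subset G -> pi^'.-group S -> exists2 y, y \in L & S :^ y \subset D.
Proof.
move=> sSG pi'S; have [g Gg sSD] := Hall_Jsub solG hallD sSG pi'S.
rewrite -Hall_complement_mul in Gg; have [y d Ly Dd def_g] := mulsgP Gg.
exists y => //; rewrite -(conjSg _ _ d) -conjsgM -def_g.
by rewrite (normP (subsetP (normG D) d Dd)).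
Qed.

Lemma Hall_complement_nil : nilpotent (G / L) -> nilpotent D.
Proof.
have nLD := subset_trans sDG (normal_norm nsLG).
rewrite (isog_nil (quotient_isog nLD Hall_complement_TI)).
by rewrite /= -[in D / L]quotientMidl Hall_complement_mul.
Qed.

(** L is a normal supplement, and each of its Sylow subgroups is normal in G. *)
Lemma Hall_complement_SS :
  (forall X, X \subset L -> X <| G) -> SS_permutable G D.
Proof.
move=> nsXG; split=> //; exists L; split.
  split; first exact: normal_sub.
  rewrite -Hall_complement_mul normC //.
  exact: subset_trans sDG (normal_norm nsLG).
move=> p P _ sylP; apply: normC; apply: subset_trans sDG (normal_norm _).
exact/nsXG/(pHall_sub sylP).
Qed.

(** The product A (R :^ x) is a pi'-group, hence lies in a conjugate D :^ y^-1 with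
    y in L; then y centralises A and x * y centralises R. *)
Lemma commute_conj_cent_mul A R :
    A \subset D -> R \subset D ->
    (forall x, x \in L -> commute (A : {set gT}) (R :^ x)) ->
  L \subset 'C_L(R) * 'C_L(A).
Proof.
move=> sAD sRD cARx; apply/subsetP=> x Lx.
have groupT : group_set (A * R :^ x) by apply/comm_group_setP/cARx.
pose S := Group groupT.
have [Gx Rpi] : x \in G /\ pi^'.-group R.
  by rewrite (subsetP (normal_sub nsLG)) // (pgroupS sRD pi'D).
have sSG : S \subset G.
  by rewrite mul_subG ?(subset_trans sAD) // conj_subG ?(subset_trans sRD).
have pi'S : pi^'.-group S.
  by rewrite [pgroup _ _]pgroupM pgroupJ Rpi (pgroupS sAD pi'D).
have [y Ly sSyD] := sub_conj_complement sSG pi'S.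
have cAy : y \in 'C(A).
  apply: (conj_sub_complement_cent nsLG sDG Hall_complement_TI sAD Ly).
  by apply: subset_trans sSyD; rewrite conjSg mulG_subl.
have cRxy : x * y \in 'C(R).
  apply: (conj_sub_complement_cent nsLG sDG Hall_complement_TI sRD).
    exact: groupM.
  by apply: subset_trans sSyD; rewrite conjsgM conjSg mulG_subr.
rewrite -(mulgK y x); apply: mem_mulg; apply/setIP; split; rewrite ?groupV //.
exact: groupM.
Qed.

(** A converse to commute_conj_cent_mul: R :^ x is the conjugate of R by an
    element centralising A. *)
Lemma cent_mul_commute_conj A R x :
    L \subset 'C_L(R) * 'C_L(A) -> commute (A : {set gT}) R -> x \in L ->
  commute (A : {set gT}) (R :^ x).
Proof.
move=> sL cAR Lx.
have /mulsgP[r a /setIP[_ cRr] /setIP[_ cAa] ->] := subsetP sL x Lx.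
rewrite conjsgM (normP (subsetP (cent_sub R) r cRr)).
rewrite -(normP (subsetP (cent_sub A) a cAa)).
by rewrite /commute -!conjsMg cAR.
Qed.

End Hall.

(** Write H = (H :&: L) A with A a pi(L)'-group contained in a complement D of L,
    and let K be a supplement witnessing that A is SS-permutable. The index of K
    in G divides the order of A, so L <= K and K = L R with R = K :&: D. Enlarge
    K to K1 = L R C, where C = 'C_D(L); this is normal because D / C is abelian.
    The Sylow q-subgroups of K1 for q outside pi(L) are the E :^ x with x in L
    and E the Sylow q-subgroup of R C. As C centralises L, E has on L at least
    the fixed points of a Sylow q-subgroup of R, so L = 'C_L(E) 'C_L(A) follows
    from the corresponding equality for R. *)
Theorem power_residual_NSS :
    solvable G -> power_residual G L ->
    (forall A, A \subset G -> \pi(L)^'.-group A -> SS_permutable G A) ->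
  forall H, H \subset G -> NSS_permutable G H.
Proof.
move=> solG [nsLG hallL sLG' nilGL nsXG] SS H sHG.
set pi := \pi(L); have hallLpi : pi.-Hall(G) L := Hall_pi hallL.
have [sLG nLG] := andP nsLG.
have [A hallA] := Hall_exists pi^' (solvableS sHG solG).
have [sAH pi'A _] := and3P hallA; have sAG := subset_trans sAH sHG.
have [D hallD sAD] := Hall_superset solG sAG pi'A.
have [sDG pi'D _] := and3P hallD; have nLD := subset_trans sDG nLG.
have defG : L * D = G := Hall_complement_mul nsLG hallL hallD.
have tiLD : L :&: D = 1 := Hall_complement_TI hallD.
have defH : (H :&: L) * A = H.
  have nsHL : H :&: L <| H.
    by rewrite /normal subsetIl normsI ?normG ?(subset_trans sHG).
  apply: sdprodW; apply/(sdprod_normal_p'HallP nsHL hallA).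
  by rewrite /= setIC (setI_normal_Hall nsLG).
have nilD : nilpotent D := Hall_complement_nil nsLG hallL hallD nilGL.
have [_ [K [[sKG defAK] permK]]] := SS A sAG pi'A.
have sLK : L \subset K.
  rewrite -indexg_eq1 -dvdn1.
  (* #|L : K| divides both #|L| and #|G : K|, which are coprime. *)
  have co : coprime #|L| #|A : K|.
    by apply: pnat_coprime (pgroup_pi L) (pnat_dvd (dvdn_indexg _ _) pi'A).
  have <- : gcdn #|L| #|A : K| = 1%N by apply/eqP.
  rewrite dvdn_gcd dvdn_indexg /=.
  have -> : #|A : K| = #|G : K|.
    apply/eqP; rewrite -(eqn_pmul2r (cardG_gt0 K)) LagrangeMr defAK.
    by rewrite mulnC Lagrange.
  rewrite -(dvdn_pmul2r (cardG_gt0 K)) LagrangeMr [X in _ %| X]mulnC Lagrange //.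
  rewrite -norm_joinEr ?(subset_trans sKG) // cardSg //.
  by rewrite join_subG sLG.
pose R := (K :&: D)%G; pose C := 'C_D(L)%G.
have sRD : R \subset D := subsetIr _ _.
have sD'C : D^`(1) \subset C.
  rewrite subsetI der_sub; apply: subset_trans (dergS 1 sDG) _.
  exact: normal_subgroups_der1_cent nsXG.
have nsCD : C <| D by rewrite sub_der1_normal ?subsetIl.
pose M := (R <*> C)%G.
have nCR : R \subset 'N(C) := subset_trans sRD (normal_norm nsCD).
have defM : R * C = M by rewrite /= norm_joinEl.
have sMD : M \subset D by rewrite join_subG sRD normal_sub.
have nsMD : M <| D.
  by rewrite sub_der1_normal // (subset_trans sD'C) // joing_subr.
pose K1 := (L <*> M)%G.
have nLM := subset_trans sMD nLD.
have defK1 : L * M = K1 by apply/esym/norm_joinEr.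
have sK1G : K1 \subset G by rewrite join_subG sLG (subset_trans sMD sDG).
have nsK1G : K1 <| G.
  rewrite /normal sK1G -{1}defG mulG_subG andTb; apply/andP; split.
    exact: subset_trans (joing_subl L M) (normG K1).
  exact: normsY nLD (normal_norm nsMD).
have sKK1 : K \subset K1.
  have defK : L * (D :&: K) = K by rewrite group_modl // defG; apply/setIidPr.
  by rewrite -defK1 -{1}defK mulgS // setIC joing_subl.
have abRC : abelian (R / C).
  apply: (abelianS (quotientS C sRD)).
  by rewrite sub_der1_abelian.
split=> //; exists K1; split=> //.
  split=> //; apply/eqP; rewrite eqEsubset mul_subG //= -{1}defAK.
  exact: mulgSS.
move=> q S q_pr sylS.
have sSG := subset_trans (pHall_sub sylS) sK1G.
have cHLS : commute (H :&: L) S.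
  apply/esym/normC; apply: subset_trans sSG (normal_norm _).
  by apply: nsXG; rewrite subsetIr.
suffices cAS : commute (A : {set gT}) S.
  by rewrite /commute -defH -mulgA cAS !mulgA cHLS.
have [pi_q | pi'q] := boolP (q \in pi).
  have sSL : S \subset L.
    rewrite (sub_normal_Hall hallLpi) //.
    exact: pi_pgroup (pHall_pgroup sylS) pi_q.
  by apply: normC; apply: subset_trans sAG (normal_norm (nsXG S sSL)).
have pi'S (T : {group gT}) : q.-group T -> pi^'.-group T.
  by move=> qT; apply: pi_pgroup qT _.
have [y Ly sSyD] :=
  sub_conj_complement solG nsLG hallL hallD sSG (pi'S _ (pHall_pgroup sylS)).
pose E := (S :^ y)%G.
have K1y : y \in K1 by rewrite (subsetP (joing_subl L M)).
have sEM : E \subset M.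
  have -> : M :=: K1 :&: D by rewrite -defK1 setIC -group_modr // setIC tiLD mul1g.
  by rewrite subsetI sSyD andbT conj_subG // (pHall_sub sylS).
have sylE : q.-Sylow(M) E.
  by apply: (pHall_subl sEM (joing_subr L M)); rewrite pHallJ.
have nsED : E <| D.
  by rewrite (nilpotent_Hall_pcore (nilpotentS sMD nilD) sylE) gFnormal_trans.
have [S0 sylS0] := Sylow_exists q K.
have sS0G := subset_trans (pHall_sub sylS0) sKG.
have [z Lz sS0D] :=
  sub_conj_complement solG nsLG hallL hallD sS0G (pi'S _ (pHall_pgroup sylS0)).
pose S1 := (S0 :^ z)%G.
have Kz := subsetP sLK z Lz.
have sylS1 : q.-Sylow(K) S1 by rewrite pHallJ.
have sS1R : S1 \subset R by rewrite subsetI sS0D (pHall_sub sylS1).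
have LS1 : L \subset 'C_L(S1) * 'C_L(A).
  apply: (commute_conj_cent_mul solG nsLG hallL hallD sAD) => // x Lx.
  by apply: (permK q (S1 :^ x)%G q_pr); rewrite pHallJ // (subsetP sLK).
(* In the abelian group R / C the q-group E / C lies in the Sylow subgroup. *)
have sES1C : E \subset C * S1.
  have nCS1 := subset_trans sS1R nCR.
  rewrite -quotientSK ?(subset_trans sSyD) ?normal_norm //.
  have sylS1R := pHall_subl sS1R (subsetIl K D) sylS1.
  rewrite (sub_normal_Hall (quotient_pHall nCS1 sylS1R)).
  - by rewrite quotient_pgroup ?(pHall_pgroup sylE).
  - by rewrite -(sub_abelian_normal _ abRC) quotientS.
  by apply: subset_trans (quotientS C sEM) _; rewrite -defM quotientMidr.
have sCE : 'C_L(S1) \subset 'C_L(E).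
  rewrite subsetI subsetIl centsC; apply: subset_trans sES1C _.
  rewrite mul_subG //; last by rewrite centsC subsetIr.
  by rewrite centsC (subset_trans (subsetIl _ _)) // centsC subsetIr.
have {LS1} LE : L \subset 'C_L(E) * 'C_L(A).
  by apply: subset_trans LS1 (mulSg _ sCE).
have -> : S :=: E :^ y^-1 by rewrite /= conjsgK.
apply: (cent_mul_commute_conj LE); rewrite ?groupV //.
apply: normC; exact: subset_trans sAD (normal_norm nsED).
Qed.

End Supplements.

(** * Passage to quotients *)

Lemma SS_permutable_quotient (gT : finGroupType) (G H N : {group gT}) :
  N <| G -> SS_permutable G H -> SS_permutable (G / N) (H / N).
Proof.
move=> nsNG [sHG [K [[sKG defG] permK]]].
have nNG := normal_norm nsNG.
have nNK := subset_trans sKG nNG; have nNH := subset_trans sHG nNG.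
split; first exact: quotientS.
exists (K / N)%G; split; first split; rewrite ?quotientS //.
  by rewrite -quotientMl // defG.
move=> p Pb p_pr sylPb; have [P sylP] := Sylow_exists p K.
have nNP := subset_trans (pHall_sub sylP) nNK.
have [_ /morphimP[k nNk Kk ->] ->] := Sylow_trans (quotient_pHall nNP sylP) sylPb.
rewrite -quotientJ //.
have sPkK : P :^ k \subset K by rewrite conj_subG // (pHall_sub sylP).
have sylPk : p.-Sylow(K) (P :^ k)%G by rewrite pHallJ.
have cHPk := permK p (P :^ k)%G p_pr sylPk.
by rewrite /commute -!quotientMl ?(subset_trans sPkK) // cHPk.
Qed.

(** As H contains N, the products H P and P H are determined by their images in
    G / N. *)
Lemma SS_permutable_cosetpre (gT : finGroupType) (G H N : {group gT}) :
    N <| G -> N \subset H -> H \subset G ->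
  SS_permutable (G / N) (H / N) -> SS_permutable G H.
Proof.
move=> nsNG sNH sHG [_ [Kb [[sKbG defGb] permKb]]].
have nNG := normal_norm nsNG.
have [K defKb sNK sKG] := inv_quotientS nsNG sKbG.
have nNH := subset_trans sHG nNG; have nNK := subset_trans sKG nNG.
have NH : N * H = H := mulSGid sNH.
split=> //; exists K; split; first split=> //.
  rewrite -(quotientGK nsNG) -defGb /= defKb -quotientMl // quotientK ?mul_subG //.
  by rewrite mulgA NH.
move=> p P p_pr sylP; have nNP := subset_trans (pHall_sub sylP) nNK.
have := permKb p (P / N)%G p_pr; rewrite defKb quotient_pHall // => /(_ isT).
rewrite /commute -!quotientMl // => eqHP.
have : N * (H * P) = N * (P * H).
  by rewrite -(quotientK (mul_subG nNH nNP)) eqHP quotientK ?mul_subG.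
by rewrite !mulgA NH -(normC nNP) -mulgA NH.
Qed.

Lemma SST_quotient (gT : finGroupType) (G N : {group gT}) :
  N <| G -> SST_group G -> SST_group (G / N)%G.
Proof.
move=> nsNG sstG Hb Kb sHKb sKGb SSK SSH.
have [K /(@group_inj _ _ (K / N)%G) defKb sNK sKG] := inv_quotientS nsNG sKGb.
have nsNK := normalS sNK sKG nsNG; rewrite {Kb}defKb in sHKb SSK SSH sKGb.
have [H /(@group_inj _ _ (H / N)%G) defHb sNH sHK] := inv_quotientS nsNK sHKb.
rewrite {Hb}defHb in SSK sHKb *; apply: (SS_permutable_quotient nsNG).
have sHG := subset_trans sHK sKG.
apply: (sstG H K) => //.
  exact: SS_permutable_cosetpre nsNK sNH sHK SSK.
exact: SS_permutable_cosetpre nsNG sNK sKG SSH.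
Qed.

(** Every subgroup of G is SS-permutable or abnormal in G. *)
Definition SS_or_abnormal (gT : finGroupType) (G : {group gT}) : Prop :=
  forall H : {group gT}, H \subset G -> SS_permutable G H \/ abnormal G H.

Lemma abnormal_quotient (gT : finGroupType) (G H N : {group gT}) :
  N <| G -> abnormal G H -> abnormal (G / N) (H / N).
Proof.
move=> nsNG [sHG abnH]; split; first exact: quotientS.
have nNG := normal_norm nsNG; have nNH := subset_trans sHG nNG.
move=> _ /morphimP[g nNg Gg ->].
rewrite -quotientJ // -quotientU -quotient_gen ?mem_quotient ?abnH //.
by rewrite subUset nNH (subset_trans (conj_subG Gg sHG)).
Qed.

Lemma SS_or_abnormal_quotient (gT : finGroupType) (G N : {group gT}) :
  N <| G -> SS_or_abnormal G -> SS_or_abnormal (G / N)%G.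
Proof.
move=> nsNG ssG Hb sHbG.
have [H /(@group_inj _ _ (H / N)%G)-> _ sHG] := inv_quotientS nsNG sHbG.
case: (ssG H sHG) => [ssH | abnH]; [left | right].
  exact: SS_permutable_quotient.
exact: abnormal_quotient.
Qed.

(** X is SS-permutable in the nilpotent group 'O_p(G), which is normal in G. *)
Lemma SST_Sylows_norm_pcore (gT : finGroupType) (G : {group gT}) :
  SST_group G -> Sylows_norm_pcore G.
Proof.
move=> sstG p q X Q sXO; apply: (pcore_SS_permutable_norm sXO).
apply: (sstG X 'O_p(G)%G) => //; first exact: pcore_sub.
  exact: SS_permutable_nilpotent (pgroup_nil (pcore_pgroup p G)) sXO.
by apply: SS_permutable_normal; apply: pcore_normal.
Qed.

(** If X is abnormal then G = 'O_p(G) is a p-group. *)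
Lemma SS_or_abnormal_Sylows_norm_pcore (gT : finGroupType) (G : {group gT}) :
  SS_or_abnormal G -> Sylows_norm_pcore G.
Proof.
move=> ssG p q X Q sXO q_pr qp sylQ.
have [ssX | abnX] := ssG X (subset_trans sXO (pcore_sub p G)).
  exact: pcore_SS_permutable_norm sXO ssX q_pr qp sylQ.
have sGO := abnormal_sub_normal (pcore_normal p G) sXO abnX.
suffices -> : Q :=: 1 by apply: sub1G.
rewrite -(setIid Q); apply/coprime_TIg/(pnat_coprime (pi := p)).
  exact: pgroupS (subset_trans (pHall_sub sylQ) sGO) (pcore_pgroup p G).
by apply: pi_pgroup (pHall_pgroup sylQ) _; rewrite !inE.
Qed.

(** * Groups in which all subgroups are NSS-permutable *)

(** A complement D of L is nilpotent, so all its subgroups are SS-permutable in D,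
    and D is SS-permutable in G. *)
Lemma SST_NSS (gT : finGroupType) (G H : {group gT}) :
  solvable G -> SST_group G -> H \subset G -> NSS_permutable G H.
Proof.
move=> solG sstG.
have [L resL] :=
  power_residual_exists SST_quotient SST_Sylows_norm_pcore solG sstG.
have [nsLG hallL _ nilGL nsXG] := resL.
move: H; apply: (power_residual_NSS solG resL) => A sAG pi'A.
have [D hallD sAD] := Hall_superset solG sAG pi'A.
apply: (sstG A D sAD (pHall_sub hallD)).
  apply: SS_permutable_nilpotent sAD.
  exact: (Hall_complement_nil nsLG hallL hallD nilGL).
exact: (Hall_complement_SS nsLG hallL hallD nsXG).
Qed.

(** An abnormal subgroup A of a nilpotent complement D of L is equal to D, which
    is SS-permutable. *)
Lemma SS_or_abnormal_NSS (gT : finGroupType) (G H : {group gT}) :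
  solvable G -> SS_or_abnormal G -> H \subset G -> NSS_permutable G H.
Proof.
move=> solG ssG.
have [L resL] := power_residual_exists SS_or_abnormal_quotient
                   SS_or_abnormal_Sylows_norm_pcore solG ssG.
have [nsLG hallL _ nilGL nsXG] := resL.
move: H; apply: (power_residual_NSS solG resL) => A sAG pi'A.
have [D hallD sAD] := Hall_superset solG sAG pi'A.
have [// | abnA] := ssG A sAG.
have nilD := Hall_complement_nil nsLG hallL hallD nilGL.
have abnAD := abnormal_sub sAD (pHall_sub hallD) abnA.
have /group_inj -> := abnormal_nilpotent nilD abnAD.
exact: (Hall_complement_SS nsLG hallL hallD nsXG).
Qed.

Theorem corollary1p11 (gT : finGroupType) (G : {group gT}) :
  solvable G ->
  [<-> SST_group G;
       forall H : {group gT}, H \subset G -> SS_permutable G H \/ abnormal G H;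
       forall H : {group gT}, H \subset G -> NSS_permutable G H \/ abnormal G H].
Proof.
move=> solG; tfae.
- by move=> sstG H sHG; left; apply/NSS_permutable_SS/SST_NSS.
- by move=> ssG H sHG; left; apply: SS_or_abnormal_NSS.
move=> nssG H K sHK sKG _ _; apply/NSS_permutable_SS/SS_or_abnormal_NSS => //.
  move=> X sXG; have [/NSS_permutable_SS|] := nssG X sXG; first by left.
  by right.
exact: subset_trans sHK sKG.
Qed.
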